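(* Let $E\subset\mathbb{R}^d$ with $\overline{\mu}(E)<\infty$. Then $E\in\mathcal{M}(\mathbb{R}^d)$ if and only if for every $A\subset\mathbb{R}^d$, $$\overline{\mu}(A)=\overline{\mu}(A\cap E)+\overline{\mu}(A\cap E^c).$$
   Context: An open $d$-dimensional interval is a set $I=\prod_{n=1}^d(a_n,b_n)\subset\mathbb{R}^d$, with $|I|=\prod_{n=1}^d(b_n-a_n)$; the empty set is included, with $|\varnothing|=0$. $\mathscr{I}(\mathbb{R}^d)$ is the collection of all such intervals. A set $E\subset\mathbb{R}^d$ is null if for every $\varepsilon>0$ it is covered by countably many $I_m\in\mathscr{I}(\mathbb{R}^d)$ with $\sum_m|I_m|<\varepsilon$; two sets are equal a.e. if their symmetric difference is null. $\Pi(\mathbb{R}^d)$ is the collection of all countable families $\{I_m\}_{m=1}^\infty\subset\mathscr{I}(\mathbb{R}^d)$ of pairwise disjoint intervals with $\mathbb{R}^d=\bigsqcup_m I_m$ a.e. For $A\subset\mathbb{R}^d$, $\operatorname{ess\,sup}_A f=\inf\{M\in\mathbb{R}:\{f>M\}\cap A\text{ is null}\}$ and $\operatorname{ess\,inf}_A f=\sup\{m\in\mathbb{R}:\{f<m\}\cap A\text{ is null}\}$. For $E\subset\mathbb{R}^d$, the outer and inner measures are $\overline{\mu}(E)=\inf_{\{I_m\}\in\Pi(\mathbb{R}^d)}\sum_m(\operatorname{ess\,sup}_{I_m}\chi_E)|I_m|$ and $\underline{\mu}(E)=\sup_{\{I_m\}\in\Pi(\mathbb{R}^d)}\sum_m(\operatorname{ess\,inf}_{I_m}\chi_E)|I_m|$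 (terms with $I_m=\varnothing$ count as $0$). $E\in\mathcal{M}(\mathbb{R}^d)$ (finite-measure set) if $\overline{\mu}(E)=\underline{\mu}(E)<\infty$. *)

(* Defs.v *)
From HB Require Import structures.
From mathcomp Require Import all_boot all_order all_algebra.
From mathcomp Require Import all_classical all_reals all_analysis.

Set Implicit Arguments.
Unset Strict Implicit.
Unset Printing Implicit Defensive.

Import Order.TTheory GRing.Theory Num.Theory.
Local Open Scope classical_set_scope.
Local Open Scope ring_scope.

Section Intervals.
Context {R : realType} {d : nat}.

(* The pair (a, b) stands for I = \prod_n (a_n, b_n), with no order assumed: if
   b_n <= a_n for some n then the interval is empty and, thanks to the maximum
   in [volume], |I| = 0.  For d > 0 the empty set is therefore an interval,
   and |I| depends only on the set of points of I. *)
Definition open_interval : Type := ('rV[R]_d * 'rV[R]_d)%type.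

Definition points (I : open_interval) : set 'rV[R]_d :=
  [set x | forall n : 'I_d, I.1 ord0 n < x ord0 n < I.2 ord0 n].

Definition volume (I : open_interval) : R :=
  \prod_(n < d) Num.max 0 (I.2 ord0 n - I.1 ord0 n).

Definition null (E : set 'rV[R]_d) : Prop :=
  forall eps : R, 0 < eps -> exists2 I : nat -> open_interval,
    E `<=` \bigcup_m points (I m) &
    (\sum_(m <oo) (volume (I m))%:E < eps%:E)%E.

Definition eq_ae (A B : set 'rV[R]_d) : Prop := null (A `+` B).

(* Finite families are covered by padding them with empty intervals, which may
   be repeated in a pairwise disjoint family. *)
Definition ae_partition : set (nat -> open_interval) :=
  [set I | trivIset setT (fun m => points (I m)) /\
           eq_ae setT (\bigcup_m points (I m))].

Definition esssup (A : set 'rV[R]_d) (f : 'rV[R]_d -> R) : \bar R :=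
  ereal_inf [set M%:E | M in [set M : R | null ([set x | M < f x] `&` A)]].

Definition essinf (A : set 'rV[R]_d) (f : 'rV[R]_d -> R) : \bar R :=
  ereal_sup [set m%:E | m in [set m : R | null ([set x | f x < m] `&` A)]].

(* If I m is empty, then esssup is -oo and essinf is +oo, but the term is still
   0 because 0 is absorbing for the product of \bar R. *)
Definition outer (E : set 'rV[R]_d) : \bar R :=
  ereal_inf [set (\sum_(m <oo)
      esssup (points (I m)) \1_E * (volume (I m))%:E)%E | I in ae_partition].

Definition inner (E : set 'rV[R]_d) : \bar R :=
  ereal_sup [set (\sum_(m <oo)
      essinf (points (I m)) \1_E * (volume (I m))%:E)%E | I in ae_partition].

Definition finite_measure_set (E : set 'rV[R]_d) : Prop :=
  outer E = inner E /\ (outer E < +oo)%E.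

End Intervals.

(* Main.v *)
Require Import Defs.
From mathcomp Require Import all_boot all_order all_algebra.
From mathcomp Require Import all_classical all_reals all_analysis.
From mathcomp Require Import ring lra.

(* Let S(E), the essential support of E, be the set of points all of whose
   neighbourhoods meet E in a non-null set.  An interval of an a.e. partition
   contributes to the outer sum of E exactly when it meets S(E), and to the inner
   sum exactly when it is disjoint from S(~E).  Refining grids shows that
   outer E = m(S(E)) and inner E = m(~S(~E)), where m is Lebesgue measure.  Since
   ~S(~E) = S(E) \ S(~E), E has finite measure iff its essential boundary
   S(E) & S(~E) is null.  As S(A) is the union of S(A & E) and S(A & ~E), whose
   intersection lies in the essential boundary of E, nullity of that boundary
   gives the splitting identity; conversely the identity for A a large box, where
   all terms are finite, shows that the boundary is null inside the box. *)

Set Implicit Arguments.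
Unset Strict Implicit.
Unset Printing Implicit Defensive.

Import Order.TTheory GRing.Theory Num.Theory.
Local Open Scope classical_set_scope.
Local Open Scope ring_scope.

Lemma volume_ge0 (R : realType) d (I : @open_interval R d) : 0 <= volume I.
Proof. by apply: prodr_ge0 => i _; rewrite le_max lexx. Qed.

Lemma lebesgue_on_intervals (R : realType) (d : nat) :
  exists (disp : measure_display) (T : measurableType disp)
    (mu : {measure set T -> \bar R}) (phi : T -> 'rV[R]_d),
  forall I : @open_interval R d, measurable (phi @^-1` points I) /\
    mu (phi @^-1` points I) = (volume I)%:E.
Proof.
elim: d => [|d [disp [T [mu [phi phiP]]]]].
  exists _, unit, (dirac tt : {measure set unit -> \bar R}), (fun=> 0) => I.
  have -> : (fun=> 0) @^-1` points I = [set: unit].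
    by apply/seteqP; split => // x _ [].
  split; first exact: measurableT.
  by rewrite /= diracE in_setT /volume big_ord0.
pose psi (z : T * measurableTypeR R) : 'rV[R]_d.+1 :=
  \row_i oapp (phi z.1 ord0) z.2 (unlift ord0 i).
exists _, (T * measurableTypeR R)%type,
  (mu \x @lebesgue_measure R : {measure set _ -> \bar R})%E, psi => I.
pose J : @open_interval R d :=
  (\row_i I.1 ord0 (lift ord0 i), \row_i I.2 ord0 (lift ord0 i)).
have -> : psi @^-1` points I =
    (phi @^-1` points J) `*` `]I.1 ord0 ord0, I.2 ord0 ord0[%classic.
  apply/seteqP; split => [[t r] h|[t r] /= [h1 h2] i].
    split => [i|]; last by move: (h ord0); rewrite mxE unlift_none /= in_itv.
    by move: (h (lift ord0 i)); rewrite !mxE liftK.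
  rewrite mxE; case: (unliftP ord0 i) => [j|] -> /=.
    by move: (h1 j); rewrite !mxE.
  by move: h2; rewrite in_itv.
have [mJ muJ] := phiP J; split; first exact: measurableX.
apply: etrans (product_measure1E _ _ mJ _) _ => //.
rewrite [X in (X * _ = _)%E]muJ [X in (_ * X = _)%E]lebesgue_measure_itv.
rewrite /= [in RHS]/volume big_ord_recl lte_fin EFinM muleC; congr (_ * _)%E.
  case: ltP => h; first by rewrite max_r// subr_ge0 ltW.
  by rewrite max_l// subr_le0.
by congr EFin; apply: eq_bigr => i _; rewrite !mxE.
Qed.

Lemma null_subset (R : realType) d (A B : set 'rV[R]_d) :
  A `<=` B -> null B -> null A.
Proof.
move=> AB nB eps /nB[I BI Ieps]; exists I => //; exact: subset_trans BI.
Qed.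

Lemma null_bigcup (R : realType) d (A : nat -> set 'rV[R]_d) :
  (forall k, null (A k)) -> null (\bigcup_k A k).
Proof.
move=> nA eps eps0.
have eps2 : 0 < eps / 2 by rewrite divr_gt0.
have /choice[I IP] : forall k, exists J : nat -> @open_interval R d,
    A k `<=` \bigcup_m points (J m) /\
    (\sum_(m <oo) (volume (J m))%:E < (eps / 2 / (2 ^ k.+1)%:R)%:E)%E.
  move=> k; have [|J AJ Jlt] := nA k (eps / 2 / (2 ^ k.+1)%:R).
    by rewrite divr_gt0// ltr0n expn_gt0.
  by exists J.
have /ppcard_eqP[f] : ([set: nat] #= [set: nat * nat])%card.
  by rewrite card_eq_sym; exact: card_nat2.
exists (fun m => I (f m).1 (f m).2).
  move=> x [k _ /(proj1 (IP k))[m _ xm]].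
  have [n _ fn] := @surj _ _ _ _ f (k, m) Logic.I.
  by exists n => //; rewrite fn.
have I0 (z : nat * nat) : (0 <= (volume (I z.1 z.2))%:E)%E.
  by rewrite lee_fin volume_ge0.
rewrite nneseries_esumT//.
rewrite -(reindex_esum [set: nat] [set: nat * nat] f
  (fun z => (volume (I z.1 z.2))%:E))//.
rewrite (_ : setT = setT `*`` (fun=> setT)); last by apply/seteqP; split.
rewrite -(@esum_esum _ _ _ _ _ (fun i j => (volume (I i j))%:E)); last first.
  by move=> i j _ _; exact: (I0 (i, j)).
apply: (@le_lt_trans _ _ (eps / 2)%:E); last by rewrite lte_fin; lra.
apply: le_trans (epsilon_trick0 xpredT (ltW eps2)).
rewrite -nneseries_esumT; last first.
  by move=> k; apply: esum_ge0 => j _; exact: (I0 (k, j)).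
apply: lee_nneseries => [k _ _|k _].
  by apply: esum_ge0 => j _; exact: (I0 (k, j)).
rewrite -nneseries_esumT; last by move=> j; exact: (I0 (k, j)).
exact/ltW/(proj2 (IP k)).
Qed.

Lemma null_hyperplane (R : realType) d (i : 'I_d) (c : R) :
  null [set x : 'rV[R]_d | x ord0 i = c].
Proof.
pose A k := [set x : 'rV[R]_d | x ord0 i = c /\
  forall j, `|x ord0 j| < k.+1%:R].
apply: (@null_subset _ _ _ (\bigcup_k A k)) => [x xc|].
  exists (\sum_j Num.truncn `|x ord0 j|)%N => //; split => // j.
  apply: lt_le_trans (truncnS_gt _) _; rewrite ler_nat ltnS.
  by rewrite (bigD1 j)//= leq_addr.
apply: null_bigcup => k eps eps0.
pose V : R := \prod_(j < d | j != i) Num.max 0 (k.+1%:R - - k.+1%:R).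
have V0 : 0 < V.
  by apply: prodr_gt0 => j _; rewrite lt_max opprK addr_gt0// orbT.
pose delta m := eps / 2 / (2 ^ m.+1)%:R / V / 2.
have delta0 m : 0 < delta m.
  by rewrite !divr_gt0// ltr0n expn_gt0.
exists (fun m => (\row_j if j == i then c - delta m else - k.+1%:R,
                  \row_j if j == i then c + delta m else k.+1%:R)).
  move=> x [xc xk]; exists 0%N => // j /=; rewrite !mxE.
  case: eqP => [->|_]; last by rewrite -ltr_norml.
  by rewrite xc ltrBlDr ltrDl delta0.
apply: (@le_lt_trans _ _ (eps / 2)%:E); last by rewrite lte_fin; lra.
have eps2 : 0 <= eps / 2 by rewrite divr_ge0// ltW.
apply: le_trans (epsilon_trick0 xpredT eps2).
apply: lee_nneseries => [m _ _|m _]; first by rewrite lee_fin volume_ge0.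
rewrite lee_fin /volume (bigD1 i)//= !mxE eqxx.
rewrite (eq_bigr (fun=> Num.max 0 (k.+1%:R - - k.+1%:R))); last first.
  by move=> j /negbTE ji; rewrite !mxE ji.
rewrite -/V max_r; last by have := delta0 m; lra.
rewrite [leLHS](_ : _ = eps / 2 / (2 ^ m.+1)%:R)// /delta.
by field; rewrite ?gt_eqF//= ltr0n expn_gt0.
Qed.

Lemma volume_gt0 (R : realType) d (I : @open_interval R d) :
  points I !=set0 -> 0 < volume I.
Proof.
move=> [x xI]; apply: prodr_gt0 => n _; rewrite lt_max subr_gt0.
by have /andP[/lt_trans h /h ->] := xI n; rewrite orbT.
Qed.

Definition interval_cap (R : realType) d (I J : @open_interval R d) :
    open_interval :=
  (\row_i Num.max (I.1 ord0 i) (J.1 ord0 i),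
   \row_i Num.min (I.2 ord0 i) (J.2 ord0 i)).

Lemma points_interval_cap (R : realType) d (I J : @open_interval R d) :
  points (interval_cap I J) = points I `&` points J.
Proof.
apply/seteqP; split => [x xIJ|x [xI xJ] n].
  by split=> n; have := xIJ n; rewrite !mxE gt_max lt_min;
    case/andP => /andP[? ?] /andP[? ?]; apply/andP.
rewrite !mxE gt_max lt_min.
by have /andP[-> ->] := xI n; have /andP[-> ->] := xJ n.
Qed.

Definition esssupport (R : realType) d (E : set 'rV[R]_d) : set 'rV[R]_d :=
  [set x | forall I, points I x -> ~ null (E `&` points I)].

Definition heavy (R : realType) d (E : set 'rV[R]_d) (I : open_interval) :=
  [set x | points I x /\ ~ null (E `&` points I)].

Lemma heavy_null (R : realType) d (E : set 'rV[R]_d) (I : open_interval) :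
  null (E `&` points I) -> heavy E I = set0.
Proof. by move=> nE; apply/seteqP; split => // x []. Qed.

Lemma heavy_not_null (R : realType) d (E : set 'rV[R]_d) (I : open_interval) :
  ~ null (E `&` points I) -> heavy E I = points I.
Proof. by move=> nE; apply/seteqP; split => // x []. Qed.

Section grid.
Context (R : realType) (d : nat).
Implicit Types (I : @open_interval R d) (x y : 'rV[R]_d) (j : 'rV[int]_d).

Definition close n x y := forall i, `|y ord0 i - x ord0 i| <= 2 / n.+1%:R.

Lemma close_points I x : points I x ->
  exists n0, forall n, (n0 <= n)%N -> forall y, close n x y -> points I y.
Proof.
move=> xI.
suff [n0 _ H] : \forall n \near \oo, forall i y, close n x y ->
    I.1 ord0 i < y ord0 i < I.2 ord0 i.
  by exists n0 => n n0n y xy i; exact: (H n n0n i y xy).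
apply: filter_forall => i; have /andP[ax xb] := xI i.
pose e := Num.min (x ord0 i - I.1 ord0 i) (I.2 ord0 i - x ord0 i) / 2.
have e0 : 0 < e by rewrite divr_gt0// lt_min !subr_gt0 ax.
have := near_infty_natSinv_lt (PosNum e0); apply: filterS => n /= ne y xy.
have : `|y ord0 i - x ord0 i| < e * 2.
  by apply: le_lt_trans (xy i) _; rewrite mulrC ltr_pM2r.
rewrite divfK ?pnatr_eq0// lt_min => /andP[].
rewrite !ltr_norml => /andP[h1 h2] /andP[h3 h4]; apply/andP; split; lra.
Qed.

Definition grid_index n x : 'rV[int]_d :=
  \row_i Num.floor (x ord0 i * n.+1%:R).

Definition cell n j : @open_interval R d :=
  (\row_i ((j ord0 i)%:~R / n.+1%:R), \row_i ((j ord0 i + 1)%:~R / n.+1%:R)).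

Definition wide_cell n j : @open_interval R d :=
  (\row_i ((j ord0 i - 1)%:~R / n.+1%:R),
   \row_i ((j ord0 i + 2)%:~R / n.+1%:R)).

Lemma points_cell n j x : points (cell n j) x <-> forall i,
  (j ord0 i)%:~R < x ord0 i * n.+1%:R < (j ord0 i)%:~R + 1.
Proof.
by split => h i; have := h i; rewrite !mxE ltr_pdivrMr// ltr_pdivlMr// intrD.
Qed.

Lemma points_wide_cell n j x : points (wide_cell n j) x <-> forall i,
  (j ord0 i)%:~R - 1 < x ord0 i * n.+1%:R < (j ord0 i)%:~R + 2.
Proof.
by split => h i; have := h i;
  rewrite !mxE ltr_pdivrMr// ltr_pdivlMr// intrB intrD.
Qed.

Lemma close_scaled n x y :
  (forall i, `|y ord0 i * n.+1%:R - x ord0 i * n.+1%:R| <= 2) -> close n x y.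
Proof.
move=> xy i; rewrite ler_pdivlMr//; have := xy i.
by rewrite -mulrBl normrM (ger0_norm (ler0n _ _)).
Qed.

Lemma close_cell n j x y : points (cell n j) x -> points (cell n j) y ->
  close n x y.
Proof.
move=> /points_cell hx /points_cell hy; apply: close_scaled => i.
rewrite ler_norml; have /andP[? ?] := hx i; have /andP[? ?] := hy i.
by apply/andP; split; lra.
Qed.

Lemma grid_indexP n x i : ((grid_index n x) ord0 i)%:~R <= x ord0 i * n.+1%:R
  < ((grid_index n x) ord0 i)%:~R + 1.
Proof. by rewrite mxE; have := floor_itv (x ord0 i * n.+1%:R); rewrite intrD. Qed.

Lemma wide_cell_grid_index n x : points (wide_cell n (grid_index n x)) x.
Proof.
by apply/points_wide_cell => i; have /andP[? ?] := grid_indexP n x i;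
  apply/andP; split; lra.
Qed.

Lemma close_wide_cell n x y :
  points (wide_cell n (grid_index n x)) y -> close n x y.
Proof.
move=> /points_wide_cell hy; apply: close_scaled => i.
rewrite ler_norml; have /andP[? ?] := grid_indexP n x i; have /andP[? ?] := hy i.
by apply/andP; split; lra.
Qed.

Lemma cell_inj n j x : points (cell n j) x -> j = grid_index n x.
Proof.
move=> /points_cell hx; apply/rowP => i; rewrite mxE; apply/esym/floor_def.
by have /andP[/ltW -> h] := hx i; rewrite intrD.
Qed.

Lemma cell_grid_index n x :
  (forall i (c : int), x ord0 i != c%:~R / n.+1%:R) ->
  points (cell n (grid_index n x)) x.
Proof.
move=> xn; apply/points_cell => i; have /andP[h ->] := grid_indexP n x i.
rewrite lt_neqAle h !andbT; apply: contra_neq (xn i ((grid_index n x) ord0 i)).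
by move=> ->; rewrite mulfK// pnatr_eq0.
Qed.

(* Each unit cube [cell 0 k] is cut by its own grid, of mesh [1 / (N k).+1]: on an
   unbounded set no uniform mesh need be fine enough. *)
Definition piece (N : 'rV[int]_d -> nat) (p : 'rV[int]_d * 'rV[int]_d) :=
  interval_cap (cell 0 p.1) (cell (N p.1) p.2).

Definition grid N (l : nat) : @open_interval R d :=
  if pickle_inv l is Some p then piece N p else (0, 0).

Lemma piece_inj N p q x : points (piece N p) x -> points (piece N q) x -> p = q.
Proof.
rewrite !points_interval_cap => -[/cell_inj p1 /cell_inj p2].
move=> [/cell_inj q1 /cell_inj q2].
by rewrite [p]surjective_pairing [q]surjective_pairing p2 q2 p1 q1.
Qed.

Lemma null_bigcup_countable (K : countType) (k0 : K) (A : K -> set 'rV[R]_d) :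
  (forall k, null (A k)) -> null (\bigcup_k A k).
Proof.
move=> nA; apply: (@null_subset _ _ _
  (\bigcup_l A (odflt k0 (unpickle l)))); last exact: null_bigcup.
by move=> x [k _ xk]; exists (pickle k) => //; rewrite pickleK.
Qed.

Lemma points00 : (0 < d)%N -> points (0, 0) = set0 :> set 'rV[R]_d.
Proof.
move=> d_gt0; apply/seteqP; split => // x /(_ (Ordinal d_gt0)) /=.
by rewrite !mxE => /andP[h /(lt_trans h)]; rewrite ltxx.
Qed.

Lemma ae_partition_grid N : (0 < d)%N -> ae_partition (grid N).
Proof.
move=> d_gt0; pose i0 := Ordinal d_gt0.
split.
  apply/trivIsetP => l l' _ _; apply: contra_neqP => /eqP/set0P[x] [].
  rewrite /grid; case Ep : (pickle_inv l) => [p|]; last first.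
    by rewrite points00.
  case Eq : (pickle_inv l') => [q|]; last by rewrite points00.
  move=> xp xq; have pq := piece_inj xp xq.
  have := pickle_invK (T := ('rV[int]_d * 'rV[int]_d)%type) l.
  have := pickle_invK (T := ('rV[int]_d * 'rV[int]_d)%type) l'.
  by rewrite Ep Eq pq /= => <- <-.
apply: (@null_subset _ _ _ (\bigcup_(t : nat * 'I_d * int)
  [set x | x ord0 t.1.2 = t.2%:~R / t.1.1.+1%:R])); last first.
  apply: (@null_bigcup_countable _ (0%N, i0, 0)) => t; exact: null_hyperplane.
move=> x [[_ xN]|[_ []//]]; apply: contrapT => xH; apply: xN.
have xn n : points (cell n (grid_index n x)) x.
  apply: cell_grid_index => i c; apply/eqP => xic; apply: xH.
  by exists (n, i, c).
exists (pickle (grid_index 0 x, grid_index (N (grid_index 0 x)) x)) => //.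
by rewrite /grid pickleK_inv points_interval_cap; split.
Qed.

End grid.

Lemma measureU_null disp (T : measurableType disp) (R : realType)
    (mu : {measure set T -> \bar R}) (X Y : set T) :
  measurable X -> measurable Y -> mu (X `&` Y) = 0%E ->
  mu (X `|` Y) = (mu X + mu Y)%E.
Proof.
move=> mX mY XY0; rewrite -(setDUK (@subsetUl _ X Y)) setDUl setDv set0U.
rewrite measureU//; [|exact: measurableD|by rewrite setDE setICA setICr setI0].
rewrite (measureDI mu mY mX) [Y `&` X]setIC; congr (_ + _)%E.
by rewrite -[LHS]adde0; congr (_ + _)%E; exact/esym.
Qed.

Section lebesgue.
Context (R : realType) (d : nat) (d_gt0 : (0 < d)%N).
Context (disp : measure_display) (T : measurableType disp).
Context (mu : {measure set T -> \bar R}) (phi : T -> 'rV[R]_d).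
Context (phiP : forall I : @open_interval R d,
  measurable (phi @^-1` points I) /\ mu (phi @^-1` points I) = (volume I)%:E).
Implicit Types E A : set 'rV[R]_d.

(* [mu] is Lebesgue measure on R^d transported along [phi]; see
   [lebesgue_on_intervals]. *)
Local Notation meas A := (measurable (phi @^-1` A)).
Local Notation m A := (mu (phi @^-1` A)).

Lemma measurable_points I : meas (points I).
Proof. exact: (phiP I).1. Qed.

Lemma measure_points I : m (points I) = (volume I)%:E.
Proof. exact: (phiP I).2. Qed.

Lemma measurable_preimage_bigcup (F : nat -> set 'rV[R]_d) :
  (forall n, meas (F n)) -> meas (\bigcup_n F n).
Proof. by move=> mF; rewrite preimage_bigcup; exact: bigcupT_measurable. Qed.

Lemma measure_le_null X Y N : meas X -> meas Y -> null N ->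
  X `<=` N `|` Y -> (m X <= m Y)%E.
Proof.
move=> mX mY nN XNY; apply/lee_addgt0Pr => e /nN[I NI Ie].
have mU : meas (\bigcup_k points (I k)).
  by apply: measurable_preimage_bigcup => k; exact: measurable_points.
have /le_trans -> // : (m X <= m (Y `|` \bigcup_k points (I k)))%E.
  apply: le_measure; rewrite ?inE//.
    by rewrite preimage_setU; exact: measurableU.
  by move=> t /XNY[/NI|]; [right|left].
rewrite preimage_setU; apply: le_trans (measureU2 _ _ _) _ => //.
apply: leeD => //; apply: le_trans (ltW Ie).
apply: le_trans (measure_sigma_subadditive mu
  (F := fun k => phi @^-1` points (I k)) _ mU _) _.
- by move=> k; exact: measurable_points.
- by rewrite preimage_bigcup.
by apply: lee_nneseries => // k _; rewrite -measure_points.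
Qed.

Lemma measure_null0 X : meas X -> null X -> m X = 0%E.
Proof.
move=> mX nX; apply/eqP; rewrite -measure_le0.
rewrite -(measure0 mu) -(preimage_set0 phi).
by apply: (measure_le_null (N := X)); rewrite ?setU0// preimage_set0.
Qed.

Lemma not_null_points (I : @open_interval R d) :
  points I !=set0 -> ~ null (points I).
Proof.
move=> /volume_gt0 I0 /(measure_null0 (measurable_points I)).
by rewrite measure_points => -[] Ie; rewrite Ie ltxx in I0.
Qed.

Lemma volume_set0 (I : @open_interval R d) : points I = set0 -> volume I = 0.
Proof.
by move=> I0; have := measure_points I; rewrite I0 preimage_set0 measure0 => -[].
Qed.

Lemma measurable_heavy E I : meas (heavy E I).
Proof.
have [nE|nE] := pselect (null (E `&` points I)).
  by rewrite heavy_null// preimage_set0; exact: measurable0.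
by rewrite heavy_not_null//; exact: measurable_points.
Qed.

Lemma esssup_volume E I :
  (esssup (points I) \1_E * (volume I)%:E = m (heavy E I))%E.
Proof.
have [I0|/set0P I0] := eqVneq (points I) set0.
  rewrite volume_set0// mule0 (_ : heavy E I = set0) ?preimage_set0 ?measure0//.
  by apply/seteqP; split => // x []; rewrite I0.
have nI := not_null_points I0.
have [nE|nE] := pselect (null (E `&` points I)).
  rewrite heavy_null// preimage_set0 measure0 /esssup.
  rewrite (_ : ereal_inf _ = 0%E) ?mul0e//; apply/eqP; rewrite eq_le.
  apply/andP; split.
    apply: ereal_inf_lbound; exists 0 => //=; apply: null_subset nE.
    by move=> x /= [+ xI]; rewrite indicE; case: (boolP (x \in E)) => [/set_mem|_];
      rewrite ?ltxx.
  apply: le_ereal_inf_tmp => _ [M nM <-]; rewrite lee_fin leNgt; apply/negP => M0.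
  apply: nI; apply: null_subset nM => x xI; split => //=.
  by apply: lt_le_trans M0 _; rewrite indicE ler0n.
rewrite heavy_not_null// measure_points.
rewrite (_ : esssup _ _ = 1%E) ?mul1e//; apply/eqP; rewrite eq_le.
apply/andP; split.
  apply: ereal_inf_lbound; exists 1 => //=.
  rewrite (_ : _ `&` _ = set0).
    apply: null_subset (null_hyperplane (Ordinal d_gt0) 0) => //.
  apply/seteqP; split => // x /= [+ _]; rewrite indicE ltNge => /negP; apply.
  by rewrite lern1; case: (_ \in _).
apply: le_ereal_inf_tmp => _ [M nM <-]; rewrite lee_fin leNgt; apply/negP => M1.
apply: nE; apply: null_subset nM => x [xE xI]; split => //=.
by rewrite indicE mem_set.
Qed.

Definition light E I := [set x | points I x /\ null (~` E `&` points I)].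

Lemma lightE E I : light E I = points I `\` heavy (~` E) I.
Proof.
apply/seteqP; split => [x [xI nE]|x [xI xh]]; first by split => // -[].
by split => //; apply: contrapT => nE; apply: xh.
Qed.

Lemma measurable_light E I : meas (light E I).
Proof.
rewrite lightE.
exact: (measurableD (measurable_points I) (measurable_heavy (~` E) I)).
Qed.

Lemma essinf_volume E I :
  (essinf (points I) \1_E * (volume I)%:E = m (light E I))%E.
Proof.
have [I0|/set0P I0] := eqVneq (points I) set0.
  rewrite volume_set0// mule0 (_ : light E I = set0) ?preimage_set0 ?measure0//.
  by apply/seteqP; split => // x []; rewrite I0.
have nI := not_null_points I0.
have [nE|nE] := pselect (null (~` E `&` points I)).
  rewrite (_ : light E I = points I); last by apply/seteqP; split => // x [].
  rewrite measure_points (_ : essinf _ _ = 1%E) ?mul1e//; apply/eqP; rewrite eq_le.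
  apply/andP; split.
    apply: ge_ereal_sup => _ [M nM <-]; rewrite lee_fin leNgt; apply/negP => M1.
    apply: nI; apply: null_subset nM => x xI; split => //=.
    by apply: le_lt_trans M1; rewrite indicE lern1; case: (_ \in _).
  apply: ereal_sup_ubound; exists 1 => //=; apply: null_subset nE.
  by move=> x /= [+ xI]; rewrite indicE; case: (boolP (x \in E)) => [|/negP xE _];
    rewrite ?ltxx//; split => // /mem_set.
rewrite (_ : light E I = set0); last by apply/seteqP; split => // x [].
rewrite preimage_set0 measure0 (_ : essinf _ _ = 0%E) ?mul0e//.
apply/eqP; rewrite eq_le; apply/andP; split.
  apply: ge_ereal_sup => _ [M nM <-]; rewrite lee_fin leNgt; apply/negP => M0.
  apply: nE; apply: null_subset nM => x [xE xI]; split => //=.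
  by rewrite indicE memNset.
apply: ereal_sup_ubound; exists 0 => //=.
apply: null_subset (null_hyperplane (Ordinal d_gt0) 0) => x /= [+ _].
by rewrite indicE ltNge ler0n.
Qed.

Lemma esssupportC E : ~` esssupport E =
  \bigcup_(p : nat * 'rV[int]_d) (points (wide_cell R p.1 p.2) `\`
     heavy E (wide_cell R p.1 p.2)).
Proof.
apply/seteqP; split => [x /existsNP[I /not_implyP[xI /contrapT nE]]|x].
  have [n0 nI] := close_points xI.
  exists (n0, grid_index n0 x) => //; split; first exact: wide_cell_grid_index.
  move=> [_]; apply; apply: null_subset nE => y [yE /close_wide_cell xy].
  by split => //; exact: (nI n0).
move=> [p _ [xp xh]] xE; apply: xh; split => //; exact: xE.
Qed.

Lemma measurable_esssupport E : meas (esssupport E).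
Proof.
rewrite -[esssupport E]setCK esssupportC -preimage_setC; apply: measurableC.
rewrite preimage_bigcup; apply: countable_bigcupT_measurable => [|p].
  exact: countableP.
exact: (measurableD (measurable_points _) (measurable_heavy E _)).
Qed.

Lemma measurable_bigcup_heavy E (K : countType) (J : K -> @open_interval R d) :
  meas (\bigcup_k heavy E (J k)).
Proof.
rewrite preimage_bigcup; apply: countable_bigcupT_measurable => [|k].
  exact: countableP.
exact: measurable_heavy.
Qed.

(* The sets [\bigcup_(n >= N) excess E z n] decrease to the empty set as [N] grows,
   inside the unit cube of index [z]. *)
Definition excess E (z : 'rV[int]_d) n :=
  (\bigcup_j heavy E (interval_cap (cell R 0 z) (cell R n j))) `\` esssupport E.

Lemma measurable_excess E z n : meas (excess E z n).
Proof.
exact: (measurableD (measurable_bigcup_heavy _ _) (measurable_esssupport E)).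
Qed.

Lemma excess_small E (z : 'rV[int]_d) (e : R) : 0 < e ->
  exists n, (m (excess E z n) <= e%:E)%E.
Proof.
move=> e0; pose B n := excess E z n; have mB n := measurable_excess E z n.
pose F N := \bigcup_n B (N + n)%N.
have mF N : meas (F N) by apply: measurable_preimage_bigcup => n; exact: mB.
have capF : \bigcap_N phi @^-1` F N = set0.
  apply/seteqP; split => // t tF.
  have [_ _ [_ xE]] := tF 0%N Logic.I; apply: xE => I xI.
  have [n0 nI] := close_points xI.
  have [n _ [[j _ [xj nEj]] _]] := tF n0 Logic.I.
  apply: contra_not nEj; apply: null_subset => y [yE yj]; split => //.
  apply: (nI _ (leq_addr n n0)).
  by move: xj yj; rewrite !points_interval_cap => -[_ xj] [_ yj];
  exact: close_cell yj.
apply: contrapT => /forallNP eB.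
have Fe N : (e%:E <= m (F N))%E.
  apply: le_trans (_ : (m (B N) <= _)%E).
    by rewrite leNgt; apply/negP => /ltW; exact: eB.
  apply: le_measure; rewrite ?inE//.
  by move=> t tB; exists 0%N => //; rewrite addn0.
have : mu \o (fun N => phi @^-1` F N) @ \oo --> mu (\bigcap_N phi @^-1` F N).
  apply: nonincreasing_cvg_mu => //.
  - apply: (@le_lt_trans _ _ (m (points (cell R 0 z)))).
      apply: le_measure; rewrite ?inE//; first exact: measurable_points.
      by move=> t [n _ [[j _ []]]]; rewrite points_interval_cap => -[].
    by rewrite (measure_points) ltry.
  - by rewrite capF; exact: measurable0.
  - apply/nonincreasing_seqP => N; apply/subsetPset => t [n _ tB].
    by exists n.+1 => //; rewrite addnS -addSn.
rewrite capF measure0 => F0.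
have : (e%:E <= lim ((mu \o (fun N => phi @^-1` F N)) @ \oo))%E.
  apply: lime_ge; last by apply: nearW => N; exact: Fe.
  by apply/cvg_ex; exists 0%E.
by rewrite (cvg_lim _ F0)// lee_fin leNgt e0.
Qed.

Lemma fine_partition E (e : R) : 0 < e -> exists2 I, ae_partition I &
  (m (\bigcup_k heavy E (I k) `\` esssupport E) <= e%:E)%E.
Proof.
move=> e0.
have /choice[N NP] : forall z : 'rV[int]_d, exists n,
    (m (excess E z n) <= (e / (2 ^ (pickle z).+1)%:R)%:E)%E.
  by move=> z; apply: excess_small; rewrite divr_gt0// ltr0n expn_gt0.
exists (@grid R d N); first exact: ae_partition_grid.
pose C l := if @pickle_inv 'rV[int]_d l is Some z then excess E z (N z) else set0.
have mC l : meas (C l).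
  rewrite /C; case: pickle_inv => [z|]; first exact: measurable_excess.
  by rewrite preimage_set0.
apply: le_trans (epsilon_trick0 xpredT (ltW e0)).
apply: le_trans (measure_sigma_subadditive mu mC _ _) _.
- exact: (measurableD (measurable_bigcup_heavy _ _) (measurable_esssupport E)).
- move=> t [[l _ []]]; rewrite /grid; case: pickle_inv => [p|] tp ntp tE.
    exists (pickle p.1) => //; rewrite /C pickleK_inv; split => //.
    by exists p.2.
  by move: tp; rewrite points00.
apply: lee_nneseries => // l _; rewrite /C.
have := pickle_invK (T := 'rV[int]_d) l; case: pickle_inv => [z /= <-|_] //.
by rewrite preimage_set0 measure0 lee_fin divr_ge0// ltW.
Qed.

Lemma sum_pieces (I : nat -> @open_interval R d) (F : nat -> set 'rV[R]_d) :
  ae_partition I -> (forall k, F k `<=` points (I k)) ->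
  (forall k, meas (F k)) -> (\sum_(k <oo) m (F k))%E = m (\bigcup_k F k).
Proof.
move=> [tI _] FI mF; rewrite preimage_bigcup measure_semi_bigcup//.
  apply/trivIsetP => k l _ _ kl; rewrite -subset0 => t [/FI tk /FI tl].
  move/trivIsetP : tI => /(_ k l Logic.I Logic.I kl) /seteqP[tI _].
  exact: (tI (phi t)).
exact: bigcupT_measurable.
Qed.

Lemma outerE E : outer E = m (esssupport E).
Proof.
have sumE I : ae_partition I ->
    (\sum_(k <oo) esssup (points (I k)) \1_E * (volume (I k))%:E)%E =
    m (\bigcup_k heavy E (I k)).
  move=> aeI; rewrite -(sum_pieces aeI).
  - by apply: eq_eseriesr => k _; rewrite (esssup_volume).
  - by move=> k x [].
  - by move=> k; exact: measurable_heavy.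
have mH (I : nat -> open_interval) : meas (\bigcup_k heavy E (I k)).
  exact: (measurable_bigcup_heavy _ I).
have mS := measurable_esssupport E.
apply/eqP; rewrite eq_le; apply/andP; split.
  apply/lee_addgt0Pr => e e0; have [I aeI Ie] := fine_partition E e0.
  apply: ge_ereal_inf; eexists; first by exists I.
  rewrite sumE//.
  have mHS := measurableD (mH I) mS.
  apply: le_trans (_ : (m (esssupport E) + _ <= _)%E); last exact: leeD2l Ie.
  apply: le_trans (measureU2 mu mS mHS); apply: le_measure; rewrite ?inE//.
    exact: (measurableU _ _ mS mHS).
  by move=> t tH; have [tS|tS] := pselect (esssupport E (phi t)); [left|right].
apply: le_ereal_inf_tmp => _ [I aeI <-]; rewrite sumE//.
apply: (measure_le_null (N := setT `+` \bigcup_k points (I k))) => //.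
  exact: aeI.2.
move=> x xS; have [[k _ xk]|xI] := pselect ((\bigcup_k points (I k)) x).
  by right; exists k => //; split => //; exact: xS.
by left; left.
Qed.

Lemma innerE E : inner E = m (~` esssupport (~` E)).
Proof.
have sumE I : ae_partition I ->
    (\sum_(k <oo) essinf (points (I k)) \1_E * (volume (I k))%:E)%E =
    m (\bigcup_k light E (I k)).
  move=> aeI; rewrite -(sum_pieces aeI).
  - by apply: eq_eseriesr => k _; rewrite (essinf_volume).
  - by move=> k x [].
  - by move=> k; exact: measurable_light.
have mL (I : nat -> open_interval) : meas (\bigcup_k light E (I k)).
  by apply: measurable_preimage_bigcup => k; exact: measurable_light.
have mH (I : nat -> open_interval) : meas (\bigcup_k heavy (~` E) (I k)).
  exact: (measurable_bigcup_heavy _ I).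
have mS := measurable_esssupport (~` E).
have mSC : meas (~` esssupport (~` E)) by exact: measurableC.
apply/eqP; rewrite eq_le; apply/andP; split.
  apply: ge_ereal_sup => _ [I aeI <-]; rewrite sumE//.
  apply: le_measure; rewrite ?inE// => t [k _ [tk nE]] tS.
  exact: tS nE.
apply/lee_addgt0Pr => e e0; have [I aeI Ie] := fine_partition (~` E) e0.
apply: le_trans (_ : (m (\bigcup_k light E (I k)) + e%:E <= _)%E); last first.
  by rewrite leeD2r//; apply: ereal_sup_ubound; exists I => //; exact: sumE.
have mHS := measurableD (mH I) mS.
apply: le_trans (_ : (m (\bigcup_k light E (I k)) + _ <= _)%E); last exact: leeD2l Ie.
apply: le_trans (measureU2 mu (mL I) mHS).
apply: (measure_le_null (N := setT `+` \bigcup_k points (I k))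
  (Y := (\bigcup_k light E (I k)) `|`
        ((\bigcup_k heavy (~` E) (I k)) `\` esssupport (~` E)))) => //.
- exact: (measurableU _ _ (mL I) mHS).
- exact: aeI.2.
move=> x xS; have [[k _ xk]|xI] := pselect ((\bigcup_k points (I k)) x).
  right; have [nE|nE] := pselect (null (~` E `&` points (I k))); last first.
    by right; split => //; exists k.
  by left; exists k.
by left; left.
Qed.

Lemma esssupportS A E : A `<=` E -> esssupport A `<=` esssupport E.
Proof.
move=> AE x xA I xI; apply: contra_not (xA I xI).
by apply: null_subset; exact: setSI.
Qed.

Lemma esssupportU A E : esssupport (A `|` E) = esssupport A `|` esssupport E.
Proof.
apply/seteqP; split; last first.
  by move=> x [|]; apply: esssupportS => y; [left|right].
move=> x xAE; apply: contrapT => /not_orP[].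
move=> /existsNP[I /not_implyP[xI /contrapT nI]].
move=> /existsNP[J /not_implyP[xJ /contrapT nJ]].
apply: (xAE (interval_cap I J)); first by rewrite points_interval_cap.
apply: (@null_subset _ _ _ (\bigcup_k (if k is 0 then A `&` points I
  else E `&` points J))); last by apply: null_bigcup => -[|k].
by rewrite points_interval_cap => y [[yA|yE] [yI yJ]]; [exists 0%N|exists 1%N].
Qed.

Lemma esssupport_setI E I :
  points I `&` esssupport E `<=` esssupport (points I `&` E).
Proof.
move=> x [xI xE] J xJ; have := xE (interval_cap I J).
by rewrite points_interval_cap setIA [E `&` _]setIC; apply.
Qed.

Lemma esssupportT : esssupport [set: 'rV[R]_d] = setT.
Proof.
apply/seteqP; split => // x _ I xI; rewrite setTI.
by apply: (not_null_points); exists x.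
Qed.

Lemma setC_esssupportC E :
  ~` esssupport (~` E) = esssupport E `\` esssupport (~` E).
Proof.
rewrite setDE; apply/esym/setIidPr => x xE.
have : esssupport (E `|` ~` E) x by rewrite setUv esssupportT.
by rewrite esssupportU => -[].
Qed.

Lemma finite_measure_setP E : (outer E < +oo)%E ->
  finite_measure_set E <-> m (esssupport E `&` esssupport (~` E)) = 0%E.
Proof.
have mS := measurable_esssupport E; have mSC := measurable_esssupport (~` E).
rewrite /finite_measure_set innerE outerE setC_esssupportC => Efin.
have -> : m (esssupport E) = (m (esssupport E `\` esssupport (~` E)) +
    m (esssupport E `&` esssupport (~` E)))%E.
  exact: measureDI.
have Dfin : m (esssupport E `\` esssupport (~` E)) \is a fin_num.
  rewrite ge0_fin_numE//; apply: le_lt_trans Efin.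
  apply: le_measure; rewrite ?inE//; first exact: measurableD.
  by move=> t [].
split=> [[+ _]|->]; last first.
  by rewrite adde0 -ge0_fin_numE.
set D := mu _ in Dfin * => /(congr1 (fun x => x - D)%E).
by rewrite addeAC subee// add0e.
Qed.

Lemma outer_split A E :
  m (esssupport E `&` esssupport (~` E)) = 0%E ->
  outer A = (outer (A `&` E) + outer (A `&` ~` E))%E.
Proof.
move=> E0; rewrite !outerE.
have -> : esssupport A = esssupport (A `&` E) `|` esssupport (A `&` ~` E).
  by rewrite -esssupportU -setIUr setUv setIT.
have mX := measurable_esssupport (A `&` E).
have mY := measurable_esssupport (A `&` ~` E).
have mE := measurable_esssupport E; have mEC := measurable_esssupport (~` E).
have XY0 : m (esssupport (A `&` E) `&` esssupport (A `&` ~` E)) = 0%E.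
  apply: subset_measure0 E0.
  - exact: measurableI.
  - exact: measurableI.
  by move=> t [t1 t2]; split; [apply: esssupportS t1|apply: esssupportS t2];
    exact: subIsetr.
exact: measureU_null.
Qed.

Definition box k : @open_interval R d := (const_mx (- k%:R), const_mx k%:R).

Lemma esssupport_box k : esssupport (points (box k)) `<=` points (box k.+1).
Proof.
move=> x xS; pose J : @open_interval R d :=
  (\row_i (x ord0 i - 1), \row_i (x ord0 i + 1)).
have xJ : points J x by move=> i; rewrite !mxE; apply/andP; split; lra.
have /set0P[y [yk yJ]] : points (box k) `&` points J != set0.
  apply/eqP => kJ0; apply: (xS _ xJ); rewrite kJ0.
  exact: null_subset (null_hyperplane (Ordinal d_gt0) 0).
move=> i; have := yk i; have := yJ i; rewrite !mxE -natr1.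
by move=> /andP[? ?] /andP[? ?]; apply/andP; split; lra.
Qed.

Lemma bigcup_box : \bigcup_k points (box k) = setT.
Proof.
apply/seteqP; split => // x _; exists (\sum_i Num.truncn `|x ord0 i|).+1%N => // i.
rewrite !mxE -ltr_norml; apply: lt_le_trans (truncnS_gt _) _.
by rewrite ler_nat ltnS (bigD1 i)//= leq_addr.
Qed.

Lemma essboundary_null E :
  (forall A, outer A = (outer (A `&` E) + outer (A `&` ~` E))%E) ->
  m (esssupport E `&` esssupport (~` E)) = 0%E.
Proof.
move=> splitE; set Z := _ `&` _.
have mE := measurable_esssupport E; have mEC := measurable_esssupport (~` E).
have mZ : meas Z by exact: measurableI.
have mZB k : meas (Z `&` points (box k)).
  exact: (measurableI _ _ mZ (measurable_points _)).
suff Z0 k : m (Z `&` points (box k)) = 0%E.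
  apply/eqP; rewrite -measure_le0.
  apply: le_trans (measure_sigma_subadditive mu mZB mZ _) _.
    by rewrite -preimage_bigcup -setI_bigcupr bigcup_box setIT.
  by rewrite eseries0.
pose A := points (box k).
have mX := measurable_esssupport (A `&` E).
have mY := measurable_esssupport (A `&` ~` E).
have mXU : (m (esssupport (A `&` E)) + m (esssupport (A `&` ~` E)) =
    m (esssupport (A `&` E) `|` esssupport (A `&` ~` E)))%E.
  by rewrite -!outerE -splitE outerE -esssupportU -setIUr setUv setIT.
have Ufin : (m (esssupport (A `&` E) `|` esssupport (A `&` ~` E)) < +oo)%E.
  apply: (@le_lt_trans _ _ (m (points (box k.+1)))); last first.
    by rewrite (measure_points) ltry.
  apply: le_measure; rewrite ?inE.
  - exact: measurableU.
  - exact: measurable_points.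
  by rewrite -esssupportU -setIUr setUv setIT => t; exact: esssupport_box.
have Xfin : (m (esssupport (A `&` E)) < +oo)%E.
  by apply: le_lt_trans Ufin; rewrite -mXU leeDl.
have I0 : m (esssupport (A `&` E) `&` esssupport (A `&` ~` E)) = 0%E.
  have h := measureUfinl mX mY Xfin.
  rewrite -preimage_setU -preimage_setI -mXU in h.
  have sfin : (m (esssupport (A `&` E)) + m (esssupport (A `&` ~` E)))%E
      \is a fin_num by rewrite mXU ge0_fin_numE.
  have bfin : m (esssupport (A `&` E) `&` esssupport (A `&` ~` E))
      \is a fin_num.
    rewrite ge0_fin_numE//; apply: le_lt_trans Xfin.
    by apply: le_measure; rewrite ?inE//; [exact: measurableI|move=> t []].
  move: h; rewrite -(fineK sfin) -(fineK bfin) -EFinB => -[h].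
  by congr EFin; lra.
apply: subset_measure0 I0 => //; first exact: measurableI.
by move=> t [[tE tEC] tA]; split; apply: esssupport_setI.
Qed.

End lebesgue.

Theorem proposition5p6 (R : realType) (d : nat) (d_gt0 : (0 < d)%N)
    (E : set 'rV[R]_d) (E_fin : (outer E < +oo)%E) :
  finite_measure_set E <->
  (forall A : set 'rV[R]_d,
     outer A = (outer (A `&` E) + outer (A `&` ~` E))%E).
Proof.
have [disp [T [mu [phi phiP]]]] := lebesgue_on_intervals R d.
rewrite (finite_measure_setP d_gt0 phiP)//; split => [E0 A|].
  exact: (outer_split d_gt0 phiP).
exact: (essboundary_null d_gt0 phiP).
Qed.
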